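(* $\kappa^3(BH_3)=\kappa^4(BH_3)=12$.
   Context: The $n$-dimensional balanced hypercube $BH_n$ ($n\ge 1$) is the simple undirected graph whose vertices are the $4^n$ tuples $(a_0,a_1,\ldots,a_{n-1})$ with each $a_j\in\{0,1,2,3\}$. The vertex $(a_0,\ldots,a_{n-1})$ is adjacent to exactly the following $2n$ vertices: (1) $(a_0\pm 1 \bmod 4,\,a_1,\ldots,a_{n-1})$; (2) for each $i$ with $1\le i\le n-1$, the two vertices $(a_0\pm 1\bmod 4,\,a_1,\ldots,a_{i-1},\,a_i+(-1)^{a_0}\bmod 4,\,a_{i+1},\ldots,a_{n-1})$. For a graph $G$ and an integer $h\ge 0$, an $h$-vertex cut of $G$ is a set $F\subset V(G)$ such that $G-F$ is disconnected and every component of $G-F$ has minimum degree at least $h$. The (restricted) $h$-connectivity $\kappa^h(G)$ is the minimum cardinality of an $h$-vertex cut of $G$, if an $h$-vertex cut exists. A statement giving a value of $\kappa^h(G)$ includes the assertion that an $h$-vertex cut exists. *)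

(* Defs.v *)
From mathcomp Require Import all_boot all_order all_algebra.

Set Implicit Arguments.
Unset Strict Implicit.
Unset Printing Implicit Defensive.

Import GRing.Theory.

Record sgraph := SGraph {
  vertex :> finType;
  adj : rel vertex;
  adj_sym : symmetric adj;
  adj_irr : irreflexive adj
}.
Arguments adj {G} : rename.

Section Graphs.
Variable G : sgraph.
Implicit Types (F C : {set G}) (h : nat).

Definition adj_minus F : rel G :=
  [rel x y | [&& x \notin F, y \notin F & adj x y]].

Definition components F : {set {set G}} :=
  equivalence_partition (connect (adj_minus F)) (~: F).

Definition disconnected_minus F : bool := 1 < #|components F|.

Definition degree_in C (x : G) : nat := #|[set y in C | adj x y]|.

(* The neutral element #|G| exceeds every degree, so it never affects the
   minimum over a nonempty [C]. *)
Definition min_degree C : nat := \big[minn/#|G|]_(x in C) degree_in C x.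

Definition vertex_cut h F : bool :=
  disconnected_minus F && [forall C in components F, h <= min_degree C].

(* [None] when there is no h-vertex cut. *)
Definition kappa h : option nat :=
  if [pick F | vertex_cut h F] is Some F0
  then Some #|[arg min_(F < F0 | vertex_cut h F) #|F|]|
  else None.

Lemma kappaP h k :
  kappa h = Some k <->
  (exists2 F, vertex_cut h F & #|F| = k) /\
  (forall F, vertex_cut h F -> k <= #|F|).
Proof.
rewrite /kappa; case: pickP => [F0 cF0 | no]; last first.
  by split=> // -[[F cF _] _]; rewrite no in cF.
case: arg_minnP => // F1 cF1 min1; split=> [[<-] | [[F cF <-] minF]].
  by split=> //; exists F1.
by congr Some; apply/eqP; rewrite eqn_leq min1 //= minF.
Qed.

End Graphs.

Section BalancedHypercube.
Local Open Scope ring_scope.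
Variable n : nat.
Implicit Types a b : n.-tuple 'Z_4.

(* [b] is obtained from [a] by adding 1 or -1 to coordinate 0 and either
   changing nothing else or adding [(-1) ^+ a`_0] to one coordinate [i > 0].
   For [n = 0], [a`_0] is the default value 0 and there is no edge. *)
Definition bh_adj : rel (n.-tuple 'Z_4) := fun a b =>
  ((b`_0 == a`_0 + 1) || (b`_0 == a`_0 - 1)) &&
  ([forall j : 'I_n, (0 < j)%N ==> (b`_j == a`_j)]
   || [exists i : 'I_n,
        [&& (0 < i)%N, b`_i == a`_i + (-1) ^+ (a`_0)%R
          & [forall j : 'I_n, (0 < j)%N && (j != i) ==> (b`_j == a`_j)]]]).

Lemma bh_adj_sym : symmetric bh_adj.
Proof.
suff imp a b : bh_adj a b -> bh_adj b a.
  by move=> a b; apply/idP/idP; apply: imp.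
case/andP=> ab0 ab.
have /andP[ba0 /eqP sgn] : ((a`_0 == b`_0 + 1) || (a`_0 == b`_0 - 1))
    && ((-1) ^+ (b`_0)%R == - (-1) ^+ (a`_0)%R :> 'Z_4).
  by case/orP: ab0 => /eqP->; case: (a`_0) => [[|[|[|[|m]]]] lt4].
rewrite /bh_adj ba0 /=; case/orP: ab => [/forallP same | /existsP[i]].
  by apply/orP; left; apply/forallP=> j; rewrite eq_sym same.
case/and3P=> i_gt0 /eqP bi /forallP same.
apply/orP; right; apply/existsP; exists i.
rewrite i_gt0 bi sgn addrK eqxx /=.
by apply/forallP=> j; rewrite [a`_j == _]eq_sym same.
Qed.

Lemma bh_adj_irr : irreflexive bh_adj.
Proof.
by move=> a; rewrite /bh_adj; case: (a`_0) => [[|[|[|[|m]]]] lt4].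
Qed.

Definition BH : sgraph := SGraph bh_adj_sym bh_adj_irr.

End BalancedHypercube.

(* Main.v *)
Require Import Defs.
From mathcomp Require Import all_boot all_algebra.

(** In [BH 3] the vertices whose coordinate 0 differs by 2 have the same
    neighbours, so [BH 3] is obtained from a cubic graph on 32 cells by
    replacing each cell with two non-adjacent twins and each edge with a
    4-cycle.  The cell graph is the honeycomb on a torus: with the three
    coordinates of [coord], whose sum is 0 on even cells and 1 on odd ones, an
    edge of direction [i] changes coordinate [i] only.

    Upper bound.  A hexagon of the honeycomb has six outer neighbours.  The 12
    vertices over them separate the 12 vertices over the hexagon from the rest,
    and every cell off these six keeps two neighbours, so every remaining vertex
    keeps degree at least 4 ([vertex_cut4_rim]).

    Lower bound.  Let [F] be a 3-vertex cut with fewer than 12 vertices, and let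
    [S] be the set of cells with both twins in [F], so that [#|S| <= 5].  A cell
    outside [S] has at most one neighbour in [S], as otherwise its vertices would
    have at most 2 neighbours left.  Such an [S] does not disconnect the
    honeycomb ([sparse_small_connected]), and connections between cells lift to
    connections between vertices ([linked_of_cells]): a contradiction.

    To see that the honeycomb minus [S] is connected, consider the lines, that is
    the 8-cycles on which one coordinate is constant; there are four disjoint
    ones for each coordinate.  Call a line bad when it has at least two cells of
    [S]; since [#|S| <= 5], at most two lines of each type are bad.  A good line
    stays connected, and two good lines of different types share two cells, not
    both in [S]; so all good lines lie in one component ([good_lines_linked]).
    A cell in another component has its three lines bad, hence each coordinate
    takes at most two values on that component.  This forces the component to
    turn at each step of a walk, always in the way that closes a hexagon, with
    the outer neighbour of every corner in [S].  That makes six cells in [S]. *)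

Set Implicit Arguments.
Unset Strict Implicit.
Unset Printing Implicit Defensive.

Import GRing.Theory.

(** * Vertex cuts of arbitrary graphs *)

Section GraphFacts.
Variable G : sgraph.
Implicit Types (F C : {set G}) (h : nat).

Lemma adj_minus_connect_sym F : connect_sym (adj_minus F).
Proof.
by apply: sym_connect_sym => x y; rewrite /adj_minus /= [adj x y]adj_sym andbCA.
Qed.

Lemma disconnectedP F :
  reflect (exists x y, [/\ x \notin F, y \notin F & ~~ connect (adj_minus F) x y])
          (disconnected_minus F).
Proof.
apply: (iffP idP) => [|[x [y [xF yF nxy]]]]; last first.
  pose K z := [set t in ~: F | connect (adj_minus F) z t].
  apply/card_gt1P; exists (K x), (K y); split.
  - by apply: imset_f; rewrite inE.
  - by apply: imset_f; rewrite inE.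
  - apply: contraNneq nxy => /setP/(_ y).
    by rewrite !inE yF connect0.
case/card_gt1P=> _ [_ [/imsetP[x xF ->] /imsetP[y yF ->] nKxy]].
rewrite !inE in xF yF; exists x, y; split=> //.
apply: contraNN nKxy => cxy; apply/eqP/setP=> z; rewrite !inE.
by rewrite (same_connect (adj_minus_connect_sym F) cxy).
Qed.

Lemma leq_min_degree h C : C != set0 ->
  (h <= min_degree C) = [forall x in C, h <= degree_in C x].
Proof.
case/set0Pn=> x0 Cx0; apply/idP/forall_inP => [hC x Cx | hC].
  apply: leq_trans hC _; rewrite /min_degree.
  elim: (index_enum G) (mem_index_enum x) => // y s IHs; rewrite inE big_cons.
  case/predU1P=> [<- | /IHs le_s]; first by rewrite Cx geq_minl.
  by case: ifP => // _; apply: leq_trans (geq_minr _ _) le_s.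
rewrite /min_degree; elim/big_ind: _ => [|m n hm hn|x /hC //]; last first.
  by rewrite leq_min hm.
exact: leq_trans (hC _ Cx0) (max_card _).
Qed.

(** The component of [x] contains every neighbour of [x] outside [F], so the
    degrees may be counted in the whole of [G - F]. *)
Lemma vertex_cutP h F :
  reflect (disconnected_minus F /\
           forall x, x \notin F -> h <= #|[set y | (y \notin F) && adj x y]|)
          (vertex_cut h F).
Proof.
pose K z := [set t in ~: F | connect (adj_minus F) z t].
have Kin x : x \notin F -> x \in K x by rewrite !inE connect0 => ->.
have degK z x : x \notin F -> x \in K z ->
    degree_in (K z) x = #|[set y | (y \notin F) && adj x y]|.
  move=> xF; rewrite !inE => /andP[_ zx]; apply: eq_card => y; rewrite !inE.
  case yF: (y \in F) => //=; case xy: (adj x y); rewrite ?andbF ?andbT //.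
  by apply: connect_trans zx (connect1 _); rewrite /adj_minus /= xF yF.
apply: (iffP andP) => -[disF degF]; split=> //.
  move=> x xF; move/forall_inP/(_ (K x)): degF.
  have KF: K x \in components F by apply: imset_f; rewrite inE.
  move/(_ KF); rewrite leq_min_degree; last by apply/set0Pn; exists x; apply: Kin.
  by move/forall_inP/(_ x (Kin x xF)); rewrite degK ?Kin.
apply/forall_inP=> _ /imsetP[x xF ->]; rewrite inE in xF.
rewrite leq_min_degree; last by apply/set0Pn; exists x; apply: Kin.
apply/forall_inP=> y yK; have yF : y \notin F by move: yK; rewrite !inE => /andP[].
by rewrite (degK x) ?degF.
Qed.

(** A cycle with one point removed is a path. *)
Lemma cycle_minus_point_connected F (c : seq G) :
  cycle adj c -> uniq c -> #|[set x in c | x \in F]| <= 1 ->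
  {in c &, forall x y, x \notin F -> y \notin F -> connect (adj_minus F) x y}.
Proof.
move=> cyc_c uniq_c c1.
have arc z p : path adj z p -> all [predC F] (z :: p) ->
    {in z :: p &, forall x y, connect (adj_minus F) x y}.
  move=> zp avoid; have zp' : path (adj_minus F) z p.
    elim: p z zp avoid => //= y p IHp z /andP[zy yp] /and3P[zF yF pF].
    by rewrite {1}/adj_minus /= zF yF zy IHp //= yF.
  move=> x y /(path_connect zp') zx /(path_connect zp') zy.
  by apply: connect_trans zy; rewrite adj_minus_connect_sym.
have [/hasP[/= s sc sF] | ] := boolP (has (mem F) c); last first.
  rewrite -all_predC; case: c cyc_c {uniq_c c1} => // z p.
  by rewrite /= rcons_path => /andP[zp _] avoid x y xc yc _ _; apply: (arc z p).
have [i p rot_c] := rot_to sc; have memc := mem_rot i c.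
move: cyc_c uniq_c; rewrite -(rot_cycle i) -(rot_uniq i) rot_c.
rewrite /= rcons_path => /andP[sp _] /andP[sp' _] x y.
rewrite -!memc rot_c !inE => /predU1P[-> _ /negP // | xp].
case/predU1P=> [-> _ /negP // | yp] _ _.
have pF : all [predC F] p.
  apply/allP=> t tp /=; apply: contraL c1 => tF; rewrite -ltnNge.
  apply/card_gt1P; exists s, t; rewrite !inE sc sF tF -memc rot_c inE tp orbT.
  by split=> //; apply: contraNneq sp' => ->.
case: p sp xp yp pF {rot_c sp' memc} => // z p /= /andP[_ zp] xp yp pF.
exact: (arc z p).
Qed.

Lemma vertex_cutW h1 h2 F :
  h1 <= h2 -> vertex_cut h2 F -> vertex_cut h1 F.
Proof.
move=> h12 /vertex_cutP[disF degF]; apply/vertex_cutP; split=> // x /degF.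
exact: leq_trans.
Qed.

End GraphFacts.

(** * The toroidal honeycomb *)

(** The parity of coordinate 0 of a vertex of [BH 3], and its coordinates 1
    and 2. *)
Definition cell := (bool * 'Z_4 * 'Z_4)%type.

Section Honeycomb.
Local Open Scope ring_scope.
Implicit Types (u v w : cell) (i j l : 'Z_3) (k : 'Z_4).

Definition sgn v : 'Z_4 := if v.1.1 then -1 else 1.

(** Direction 2 changes the parity only; it is a step along the third honeycomb
    coordinate, see [coord]. *)
Definition step i v : cell :=
  (~~ v.1.1, if i == 0 then v.1.2 + sgn v else v.1.2,
             if i == 1 then v.2 + sgn v else v.2).

(** The third coordinate makes the honeycomb symmetric in the three directions:
    the sum of the coordinates is the parity of the cell. *)
Definition coord i v : 'Z_4 :=
  if i == 0 then v.1.2 else if i == 1 then v.2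
  else (v.1.1 : nat)%:R - v.1.2 - v.2.

Definition hadj u v := [|| v == step 0 u, v == step 1 u | v == step 2 u].

(* Explicit enumerations, over which boolean checks reduce by computation. *)
Definition directions : seq 'Z_3 := [:: 0; 1; 2].
Definition residues : seq 'Z_4 := [:: 0; 1; 2; 3].
Definition cells : seq cell := [seq (ea, b) |
   ea <- [seq (e, a) | e <- [:: false; true], a <- residues], b <- residues].

Lemma mem_directions i : i \in directions.
Proof. by case: i => [[|[|[|m]]] lt]. Qed.

Lemma mem_residues k : k \in residues.
Proof. by case: k => [[|[|[|[|m]]]] lt]. Qed.

Lemma mem_cells v : v \in cells.
Proof.
case: v => ea b; rewrite allpairs_f ?mem_residues //.
case: ea => e a; rewrite allpairs_f ?mem_residues //.
by case: e.
Qed.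

Lemma hadjP u v : reflect (exists i, v = step i u) (hadj u v).
Proof.
apply: (iffP or3P) => [[] /eqP-> | [i ->]]; try by eexists.
by have := mem_directions i; rewrite !inE => /or3P[] /eqP->;
   [constructor 1 | constructor 2 | constructor 3].
Qed.

Lemma for_cells (P : pred cell) : all P cells -> forall v, P v.
Proof. by move=> /allP Pall v; apply: Pall (mem_cells v). Qed.

Lemma for_directions (P : pred 'Z_3) : all P directions -> forall i, P i.
Proof. by move=> /allP Pall i; apply: Pall (mem_directions i). Qed.

Lemma for_residues (P : pred 'Z_4) : all P residues -> forall k, P k.
Proof. by move=> /allP Pall k; apply: Pall (mem_residues k). Qed.

Lemma stepK i : involutive (step i).
Proof.
move=> v; apply/eqP; move: v; apply: for_cells.
by move: i; apply: for_directions; vm_compute.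
Qed.

Lemma hadj_sym : symmetric hadj.
Proof.
by move=> u v; apply/idP/idP => /hadjP[i ->]; apply/hadjP; exists i;
rewrite stepK.
Qed.

Lemma hadj_irr : irreflexive hadj.
Proof.
by move=> v; apply: negbTE; move: v; apply: for_cells; vm_compute.
Qed.

Definition honeycomb : sgraph := SGraph hadj_sym hadj_irr.

Lemma coord_step i v : coord i (step i v) = coord i v + sgn v.
Proof.
apply/eqP; move: v; apply: for_cells.
by move: i; apply: for_directions; vm_compute.
Qed.

Lemma coord_step_neq i j v : i != j -> coord j (step i v) = coord j v.
Proof.
move=> ij; apply/eqP; move: ij; apply/implyP; move: v; apply: for_cells.
by move: i; apply: for_directions; move: j; apply: for_directions; vm_compute.
Qed.

(** Alternating the two directions other than [i] keeps coordinate [i] constant;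
    the four values of the other coordinates, each met twice, give a cycle of
    length 8. *)
Definition along i v := step (if v.1.1 then i + 1 else i + 2) v.
Definition line i v := traject (along i) v 8.

Lemma line_cycle i v : cycle hadj (line i v).
Proof.
move: v; apply: for_cells.
by move: i; apply: for_directions; vm_compute.
Qed.

Lemma line_uniq i v : uniq (line i v).
Proof.
move: v; apply: for_cells.
by move: i; apply: for_directions; vm_compute.
Qed.

Lemma mem_line i v u : (u \in line i v) = (coord i u == coord i v).
Proof.
apply/eqP; move: v; apply: for_cells; move: u; apply: for_cells.
by move: i; apply: for_directions; vm_compute.
Qed.

(** Two coordinates determine the third up to the choice of the parity, so the
    two lines share exactly the two ends of an edge of the third direction. *)
Lemma lines_meet i j k m : i != j ->
  exists2 v, coord i v = k & coord j v = m.
Proof.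
suff: (i != j) ==> has [pred v | (coord i v == k) && (coord j v == m)] cells.
  by move=> /implyP meet /meet/hasP[v _ /andP[/eqP vk /eqP vm]]; exists v.
move: i; apply: for_directions; move: j; apply: for_directions.
by move: k; apply: for_residues; move: m; apply: for_residues; vm_compute.
Qed.

(** The three directions, taken in turn twice, walk around a hexagon: each
    coordinate is changed once from an even cell and once from an odd one, with
    opposite signs. *)
Lemma hexagonK i j l v : uniq [:: i; j; l] ->
  step j (step l (step i (step j (step l (step i v))))) = v.
Proof.
move=> ijl; apply/eqP; move: ijl; apply/implyP; move: v; apply: for_cells.
move: i; apply: for_directions; move: j; apply: for_directions.
by move: l; apply: for_directions; vm_compute.
Qed.

(** The torus is large enough for a hexagon to have six distinct outer
    neighbours, one for each corner. *)
Lemma hexagon_rim_uniq i j l v : uniq [:: i; j; l] ->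
  let h1 := step i v in let h2 := step l h1 in let h3 := step j h2 in
  let h4 := step i h3 in let h5 := step l h4 in
  uniq [:: step j h1; step i h2; step l h3; step j h4; step i h5; step l v].
Proof.
apply/implyP; move: v; apply: for_cells.
move: i; apply: for_directions; move: j; apply: for_directions.
by move: l; apply: for_directions; vm_compute.
Qed.

Lemma third_direction i j : i != j -> exists l, uniq [:: i; j; l].
Proof.
move=> ij; exists (- (i + j)); move: ij; apply/implyP.
by move: i; apply: for_directions; move: j; apply: for_directions; vm_compute.
Qed.

Lemma sgn_step i v : sgn (step i v) = - sgn v.
Proof. by case: v => [[[] a] b]; rewrite /sgn ?opprK. Qed.

Lemma three_residues v k : uniq [:: k; k + sgn v; k - sgn v].
Proof.
move: v; apply: for_cells; move: k; apply: for_residues; by vm_compute.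
Qed.

End Honeycomb.

(** * Sparse sets of at most five cells do not disconnect the honeycomb *)

Section SparseSmallCut.

Variable S : {set honeycomb}.
Hypothesis small_S : #|S| <= 5.
Hypothesis sparse_S : forall (v : cell) (i j : 'Z_3), v \notin S -> i != j ->
  step i v \in S -> step j v \notin S.

(** A line is named by its direction [i] and the value [k] of that coordinate. *)
Definition bad (i : 'Z_3) k := 1 < #|[set v in S | coord i v == k]|.

(** The four lines of a given type partition the honeycomb, and three bad ones
    would contain six cells of [S]. *)
Lemma card_bad i : #|bad i| <= 2.
Proof.
have: \sum_(k in bad i) 2 <= #|S|.
  rewrite -sum1_card (partition_big (coord i) predT) //=.
  rewrite [leqRHS](bigID (bad i)) /=.
  apply: leq_trans (leq_addr _ _); apply: leq_sum => k bad_k.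
  by rewrite sum1dep_card.
rewrite sum_nat_const => /leq_trans/(_ small_S).
by case: #|_| => [|[|[|m]]].
Qed.

Lemma good_exists i : exists k, ~~ bad i k.
Proof.
apply/existsP; rewrite -negb_forall; apply/forallP=> all_bad.
have := card_bad i; rewrite (eq_card (B := 'Z_4)) ?card_ord //.
Qed.

Local Notation linked := (connect (@adj_minus honeycomb S)).

Lemma linked_sym u v : linked u v = linked v u.
Proof. exact: (@adj_minus_connect_sym honeycomb). Qed.

Lemma good_line_linked i (u v : cell) :
  ~~ bad i (coord i v) -> coord i u = coord i v ->
  u \notin S -> v \notin S -> linked u v.
Proof.
rewrite -leqNgt => good uv uS vS.
have memL (w : honeycomb) :
  (w \in (line i v : seq honeycomb)) = (coord i w == coord i v).
  exact: mem_line.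
have conn := @cycle_minus_point_connected honeycomb S (line i v)
               (line_cycle i v) (line_uniq i v).
apply: conn => //; rewrite ?memL ?uv //.
apply: leq_trans good; apply/eq_leq/eq_card => w.
by rewrite inE memL inE andbC.
Qed.

(** The two common cells of the lines cannot both lie in [S], for the line
    [(i, k)] would be bad. *)
Lemma good_lines_meet i j k m : i != j -> ~~ bad i k ->
  exists v : cell, [/\ v \notin S, coord i v = k & coord j v = m].
Proof.
move=> ij good; have [v vk vm] := lines_meet k m ij.
have [l ijl] := third_direction ij.
have [li lj]: l != i /\ l != j.
  by move: ijl; rewrite /= !inE !(eq_sym l) => /and3P[/norP[_ ->] ->].
have [vS | vS] := boolP ((v : honeycomb) \in S); last by exists v.
exists (step l v); rewrite !coord_step_neq //; split=> //.
apply: contra good => lvS; apply/card_gt1P; exists v, (step l v).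
rewrite !inE vS lvS coord_step_neq // vk eqxx; split=> //.
by apply/eqP=> /(congr1 (fun w : cell => w.1.1)) /=; case: (v.1.1).
Qed.

(** Good lines of different types meet outside [S]; parallel ones are linked
    through a good line of another type. *)
Lemma good_lines_linked i j (u v : cell) : u \notin S -> v \notin S ->
  ~~ bad i (coord i u) -> ~~ bad j (coord j v) -> linked u v.
Proof.
move=> uS vS; have transversal d e (x y : cell) : d != e ->
    x \notin S -> y \notin S -> ~~ bad d (coord d x) -> ~~ bad e (coord e y) ->
    linked x y.
  move=> de xS yS gx gy; have [p [pS px py]] := good_lines_meet (coord e y) de gx.
  have xp : linked x p by rewrite linked_sym; apply: good_line_linked px _ _.
  by apply: connect_trans xp _; apply: good_line_linked py _ _.
have [<-{j} | ij] := eqVneq i j; last exact: transversal.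
have ii1 : i != (i + 1)%R by move: i; apply: for_directions; vm_compute.
have [k good_k] := good_exists (i + 1)%R.
move=> gu gv; have [p [pS _ pk]] := good_lines_meet k ii1 gu.
have up : linked u p by apply: transversal ii1 _ _ _ _; rewrite ?pk.
apply: connect_trans up _.
by apply: (transversal (i + 1)%R i); rewrite ?pk // eq_sym.
Qed.

(** A component that avoids the good lines contains a hexagon whose six outer
    neighbours lie in [S]. *)
Lemma sparse_small_connected (u v : cell) : u \notin S -> v \notin S -> linked u v.
Proof.
have [k0 good0] := good_exists 0%R.
have [v0 [v0S v0k _]] := @good_lines_meet 0%R 1%R k0 0%R isT good0.
suffices reach x : x \notin S -> linked v0 x.
  by move=> /reach; rewrite linked_sym => uv0 /reach; apply: connect_trans.
move=> xS; apply/negPn/negP=> nx.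
(* [U] is the part not linked to [v0], which lies on a good line. *)
pose U (w : cell) := (w \notin S) && ~~ linked v0 w.
have U_bad w i : U w -> bad i (coord i w).
  case/andP=> wS; apply: contraNT => good_w.
  by apply: (@good_lines_linked 0%R i); rewrite ?v0k.
have U_step w i : U w -> (step i w \in S) = false -> U (step i w).
  case/andP=> wS nw sS; rewrite /U sS; apply: contra nw => /connect_trans; apply.
  apply: connect1; rewrite /adj_minus /= sS wS hadj_sym.
  by apply/hadjP; exists i.
(* Were [step j (step i w)] in [U], coordinate [j] would take three values on
   [U], the other two being those of [w] and [step j w].  As [step i w] has only one neighbour in
   [S], its remaining neighbour is in [U]. *)
have corner i j l w : uniq [:: i; j; l] -> U w -> U (step i w) -> U (step j w) ->
    step j (step i w) \in S /\ U (step l (step i w)).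
  move=> ijl Uw Uiw Ujw.
  have [ij lj]: i != j /\ j != l.
    by move: ijl; rewrite /= !inE => /and3P[/norP[-> _] ->].
  have jiS : step j (step i w) \in S.
    apply: contraT => /negbTE/(U_step _ _ Uiw) Ujiw.
    have := card_bad j; rewrite leqNgt => /negP[].
    have := three_residues w (coord j w) => uniq3.
    rewrite -[3]/(size [:: coord j w; coord j w + sgn w; coord j w - sgn w])%R.
    rewrite cardE uniq_leq_size // => k; rewrite mem_enum !inE.
    case/or3P=> /eqP->; first exact: U_bad.
      by rewrite -coord_step; apply: U_bad.
    by rewrite -(sgn_step i) -(coord_step_neq w ij) -coord_step; apply: U_bad.
  split=> //; apply: U_step => //; apply: negbTE.
  by apply: sparse_S jiS; case/andP: Uiw.
have Ux : U x by rewrite /U xS.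
have [i [j [ij Ui Uj]]] : exists i j, [/\ i != j, U (step i x) & U (step j x)].
  have alt i j : i != j -> U (step i x) || U (step j x).
    move=> ij; case iS: (step i x \in S); last by rewrite U_step.
    by rewrite (U_step _ j) ?orbT //; apply/negbTE/(sparse_S xS ij iS).
  case U0: (U (step 0%R x)).
    by have /orP[U1 | U2] := alt 1%R 2%R isT; [exists 0%R, 1%R | exists 0%R, 2%R].
  have := alt 0%R 1%R isT; have := alt 0%R 2%R isT; rewrite U0 /= => U2 U1.
  by exists 1%R, 2%R.
have [l ijl] := third_direction ij.
have lij : uniq [:: l; i; j] by rewrite -(rotr_uniq 1) in ijl.
have jli : uniq [:: j; l; i] by rewrite -(rotr_uniq 1) in lij.
(* Each turn yields the next corner of the hexagon and one outer neighbour. *)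
pose h1 := step i x; pose h2 := step l h1; pose h3 := step j h2.
pose h4 := step i h3; pose h5 := step l h4.
have [S1 U2] := corner i j l x ijl Ux Ui Uj.
have [|S2 U3] := corner l i j h1 lij Ui U2; first by rewrite stepK.
have [|S3 U4] := corner j l i h2 jli U2 U3; first by rewrite stepK.
have [|S4 U5] := corner i j l h3 ijl U3 U4; first by rewrite stepK.
have [|S5 U6] := corner l i j h4 lij U4 U5; first by rewrite stepK.
have [|S6 _] := corner j l i h5 jli U5 U6; first by rewrite stepK.
rewrite [step j _]hexagonK // in S6.
suff: 6 <= #|S| by rewrite leqNgt ltnS small_S.
rewrite cardE; apply: uniq_leq_size (hexagon_rim_uniq x ijl) _ => w.
by rewrite mem_enum !inE; do 5?[case/predU1P=> [-> //|]] => /eqP->.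
Qed.

End SparseSmallCut.

(** * The twin structure of the balanced hypercube *)

Definition cell_of (x : BH 3) : honeycomb :=
  (odd (x`_0)%R, (x`_1)%R, (x`_2)%R).

Definition twin (t : bool) (q : honeycomb) : BH 3 :=
  [tuple ((q.1.1 + t.*2)%:R)%R; q.1.2; q.2].

Lemma ord3_forall (P : pred 'I_3) :
  [forall j, P j] = [&& P (inord 0), P (inord 1) & P (inord 2)].
Proof.
apply/forallP/and3P => [H | [P0 P1 P2] [[|[|[|m]]] lt]] //.
- by move: P0; congr P; apply: val_inj; rewrite /= inordK.
- by move: P1; congr P; apply: val_inj; rewrite /= inordK.
- by move: P2; congr P; apply: val_inj; rewrite /= inordK.
Qed.

Lemma ord3_exists (P : pred 'I_3) :
  [exists j, P j] = [|| P (inord 0), P (inord 1) | P (inord 2)].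
Proof.
by rewrite -[LHS]negbK negb_exists ord3_forall !negb_and !negbK.
Qed.

(** A neighbour of [x] moves coordinate 0 by 1 or -1, which only matters through
    its parity; that parity also gives the sign [(-1) ^+ a`_0]. *)
Lemma adj_cell_of (x y : BH 3) : adj x y = adj (cell_of x) (cell_of y).
Proof.
have I12 : (inord 1 == inord 2 :> 'I_3) = false by rewrite -val_eqE /= !inordK.
rewrite /= /bh_adj ord3_exists !ord3_forall !inordK //= !eqxx.
rewrite [inord 2 == _]eq_sym I12.
rewrite -[((-1) ^+ (x`_0)%R)%R]signr_odd /cell_of /hadj /step /sgn /= !xpair_eqE.
have -> : ((y`_0 == x`_0 + 1) || (y`_0 == x`_0 - 1))%R =
    (odd (y`_0)%R == ~~ odd (x`_0)%R).
  apply/eqP; move: (x`_0)%R; apply: for_residues; move: (y`_0)%R.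
  by apply: for_residues; vm_compute.
have -> : ((-1) ^+ odd (x`_0)%R = if odd (x`_0)%R then -1 else 1 :> 'Z_4)%R.
  by case: odd.
rewrite !andbT /=.
case: (_ == ~~ _) => //=; rewrite orbC -orbA; congr (_ || (_ || _)).
exact: andbC.
Qed.

Lemma cell_of_twin t q : cell_of (twin t q) = q.
Proof.
case: q => [[e a] b]; rewrite /cell_of /=; congr (_, _, _).
by case: e; case: t.
Qed.

Lemma cell_of_fibre q : cell_of @^-1: [set q] = [set twin false q; twin true q].
Proof.
apply/setP=> x; rewrite !inE; apply/eqP/orP => [<- | [] /eqP->]; last first.
- exact: cell_of_twin.
- exact: cell_of_twin.
case: x => [[|a0 [|a1 [|a2 [|? ?]]]] sz_x] //=.
have: (a0 == (odd a0 + false.*2)%:R%R) || (a0 == (odd a0 + true.*2)%:R%R).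
  by move: a0 {sz_x}; apply: for_residues; vm_compute.
by case/orP=> /eqP E; [left | right]; apply/eqP/val_inj => /=; rewrite -E.
Qed.

Lemma card_cell_of_preim (S : {set honeycomb}) : #|cell_of @^-1: S| = #|S| * 2.
Proof.
rewrite -sum1_card (partition_big cell_of (mem S)) => [|x]; last by rewrite !inE.
rewrite -sum_nat_const; apply: eq_bigr => q qS.
rewrite sum1dep_card (_ : [set _ | _] = cell_of @^-1: [set q]).
  rewrite cell_of_fibre cards2 (_ : twin false q != twin true q) //.
  apply/eqP=> /(congr1 (fun x : BH 3 => (x`_0)%R)) /=.
  by case: q.1.1.
apply/setP=> x; rewrite !inE.
by rewrite andb_idl // => /eqP->.
Qed.

(** * Lower bound *)

Definition full_cells (F : {set BH 3}) : {set honeycomb} :=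
  [set q | cell_of @^-1: [set q] \subset F].

Lemma full_cellsPn (F : {set BH 3}) (q : honeycomb) :
  reflect (exists2 x, cell_of x = q & x \notin F) (q \notin full_cells F).
Proof.
rewrite inE; apply: (iffP subsetPn) => -[x]; rewrite ?inE => /eqP-xq xF.
  by exists x.
by exists x; rewrite // !inE.
Qed.

(** A path of cells lifts through any choice of vertices outside [F] over its
    cells; two such twins are linked by any common neighbour outside [F]. *)
Lemma linked_of_cells (F : {set BH 3}) x y :
  (forall z, z \notin F -> exists2 t, t \notin F & adj z t) ->
  x \notin F -> y \notin F ->
  connect (adj_minus (full_cells F)) (cell_of x) (cell_of y) ->
  connect (adj_minus F) x y.
Proof.
move=> nbr xF yF /connectP[p]; elim/last_ind: p y yF => [|p q IHp] y yF /=.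
  move=> _ yx; have [z zF xz] := nbr x xF.
  have zy : adj z y by rewrite adj_sym adj_cell_of yx -adj_cell_of.
  by apply: (@connect_trans _ _ z); apply: connect1; apply/and3P.
rewrite rcons_path last_rcons => /andP[xp].
case/and3P=> /full_cellsPn[z zq zF] _ qz yq.
apply: (@connect_trans _ _ z); first exact: IHp.
by apply: connect1; apply/and3P; rewrite adj_cell_of zq yq.
Qed.

Lemma neighbours_in_cell (x : BH 3) (A : {set BH 3}) (B : {set honeycomb}) :
  {in A, forall y, adj x y -> cell_of y \in B} ->
  #|[set y in A | adj x y]| <= #|B| * 2.
Proof.
move=> AB; rewrite -card_cell_of_preim subset_leq_card //.
by apply/subsetP=> y; rewrite !inE => /andP[yA xy]; apply: AB.
Qed.

(** If two neighbouring cells of a vertex were contained in [F], all its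
    neighbours outside [F] would be in the third one, which has two vertices. *)
Lemma vertex_cut3_card (F : {set BH 3}) : vertex_cut 3 F -> 12 <= #|F|.
Proof.
case/vertex_cutP=> /disconnectedP[x [y [xF yF nxy]]] deg3.
rewrite leqNgt; apply: contra nxy => small_F.
have nbr z : z \notin F -> exists2 t, t \notin F & adj z t.
  move=> /deg3 deg_z; have/card_gt0P[t] := ltnW (ltnW deg_z).
  by rewrite inE => /andP[tF zt]; exists t.
have outside z : z \notin F -> cell_of z \notin full_cells F.
  by move=> zF; apply/full_cellsPn; exists z.
apply: linked_of_cells => //; apply: sparse_small_connected; try exact: outside.
  have le_F : #|cell_of @^-1: full_cells F| <= #|F|.
    apply: subset_leq_card; apply/subsetP=> z; rewrite !inE => /subsetP; apply.
    by rewrite !inE.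
  move: (leq_ltn_trans le_F small_F); rewrite card_cell_of_preim.
  by case: #|_| => [|[|[|[|[|[|m]]]]]].
move=> v i j /full_cellsPn[z <- zF] ij iS; apply/negP=> jS.
have [l ijl] := third_direction ij.
have := deg3 z zF; rewrite leqNgt => /negP[].
have := @neighbours_in_cell z (~: F) [set step l (cell_of z)].
rewrite cards1 mul1n ltnS => le2.
have ->: [set y | (y \notin F) && adj z y] = [set y in ~: F | adj z y].
  by apply/setP=> t; rewrite !inE.
apply: le2 => t; rewrite inE => tF; rewrite adj_cell_of => /hadjP[d td].
have := outside t tF; rewrite td in_set1 => dS.
have: d \in [:: i; j; l].
  move: ijl; apply/implyP; move: d {td dS}; apply: for_directions.
  move: i {ij iS}; apply: for_directions; move: j {jS}; apply: for_directions.
  by move: l; apply: for_directions; vm_compute.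
by rewrite !inE => /or3P[] /eqP Ed //; rewrite Ed ?iS ?jS in dS *.
Qed.

(** * A cut with twelve vertices *)

Definition hexagon : seq cell :=
  let h0 := (false, 0, 0)%R in let h1 := step 0%R h0 in let h2 := step 2%R h1 in
  let h3 := step 1%R h2 in let h4 := step 0%R h3 in
  [:: h0; h1; h2; h3; h4; step 2%R h4].

Definition on_rim (q : cell) := (q \notin hexagon) && has (hadj q) hexagon.

Definition rim : {set honeycomb} := [set q : cell | on_rim q].

Lemma card_rim : #|rim| = 6.
Proof.
have -> : #|rim| = #|([seq q <- cells | on_rim q] : seq honeycomb)|.
  by apply: eq_card => q; rewrite inE [RHS]mem_filter mem_cells andbT.
by apply/card_uniqP; vm_compute.
Qed.

(** The outer neighbours of a hexagon are so spread out that no cell off the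
    rim is adjacent to two of them. *)
Lemma two_steps_off_rim v : v \notin rim ->
  exists i j, [/\ i != j, step i v \notin rim & step j v \notin rim].
Proof.
pose P v i j := [&& i != j, ~~ on_rim (step i v) & ~~ on_rim (step j v)].
have: ~~ on_rim v ==> has (fun i => has (P v i) directions) directions.
  by move: v; apply: for_cells; vm_compute.
move=> /implyP off; rewrite inE => /off/hasP[i _ /hasP[j _ /and3P[ij iv jv]]].
by exists i, j; rewrite !inE.
Qed.

(** The two neighbouring cells off the rim contribute four neighbours. *)
Lemma vertex_cut4_rim : vertex_cut 4 (cell_of @^-1: rim).
Proof.
set F := _ @^-1: _; have F_E x : (x \in F) = (cell_of x \in rim) by rewrite inE.
apply/vertex_cutP; split.
  (* [x] is over a corner of the hexagon, [y] over a cell far from it. *)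
  pose x := twin false (false, 0, 0)%R.
  pose y := twin false (false, 2%:R, 2%:R)%R.
  apply/disconnectedP; exists x, y; rewrite !F_E !cell_of_twin !inE; split=> //.
  pose A := [pred z : BH 3 | (cell_of z : cell) \in hexagon].
  have clA : closed (adj_minus F) A.
    apply: intro_closed => [|z t]; first exact: adj_minus_connect_sym.
    case/and3P=> _; rewrite F_E inE adj_cell_of adj_sym => tF zt zA.
    apply: contraR tF => tA; apply/andP; split=> //.
    by apply/hasP; exists (cell_of z).
  by apply/negP=> /(closed_connect clA); rewrite !inE !cell_of_twin.
move=> x; rewrite F_E => /two_steps_off_rim[i [j [ij iF jF]]].
pose p := step i (cell_of x); pose q := step j (cell_of x).
have <- : #|cell_of @^-1: [set p; q]| = 4.
  rewrite card_cell_of_preim cards2 (_ : p != q) //.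
  move: ij; rewrite /p /q; apply/implyP; move: (cell_of x).
  apply: for_cells; move: i {iF p}; apply: for_directions; move: j {jF q}.
  by apply: for_directions; vm_compute.
apply/subset_leq_card/subsetP=> y y_pq; rewrite inE F_E adj_cell_of.
have /orP[] : (cell_of y == p) || (cell_of y == q) by move: y_pq; rewrite !inE.
all: by move=> /eqP->; rewrite ?iF ?jF; apply/hadjP; eexists.
Qed.

Theorem theorem13 : kappa (BH 3) 3 = Some 12 /\ kappa (BH 3) 4 = Some 12.
Proof.
have card_F : #|cell_of @^-1: rim| = 12 by rewrite card_cell_of_preim card_rim.
split; apply/kappaP; split.
- by exists (cell_of @^-1: rim) => //; apply: vertex_cutW vertex_cut4_rim.
- exact: vertex_cut3_card.
- by exists (cell_of @^-1: rim) => //; apply: vertex_cut4_rim.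
- by move=> F cutF; apply: vertex_cut3_card; apply: vertex_cutW cutF.
Qed.
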